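(* The class of normal means is minimal and complete. That is: (minimality) if $M_1,M_2$ are normal means with $Q_{M_1}=Q_{M_2}$, then $M_1=M_2$; (completeness) for every infinitely differentiable function $f:(0,+\infty)\to\mathbb{R}$ there exists a normal mean $M$ with $Q_M=f$.
   Context: A mean is a function $M:(0,+\infty)^2\to(0,+\infty)$ of class $C^\infty$ such that $\min(x,y)\le M(x,y)\le\max(x,y)$ and $M(x,y)=M(y,x)$ for all $x,y>0$. The characteristic function of a mean $M$ is $Q_M:(0,+\infty)\to\mathbb{R}$, $Q_M(x):=\frac{\partial^2 M}{\partial x^2}(x,x)$ (second partial derivative with respect to the first variable, evaluated at $(x,x)$). A mean $M$ is normal if there is a positive infinitely differentiable function $P$ on $(0,+\infty)$ such that $M(x,y)=\frac{xP(x)+yP(y)}{P(x)+P(y)}$ for all $x,y>0$. *)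

(* Defs.v *)
From Stdlib Require Import Reals.
From Coquelicot Require Import Coquelicot.
Open Scope R_scope.

(** Functions on (0,+oo) and (0,+oo)^2 are represented by total functions on R
    and R^2; only their values at positive arguments are relevant. *)

Definition smooth_pos (f : R -> R) : Prop :=
  forall (n : nat) (x : R), 0 < x -> ex_derive_n f n x.

(** [ex_diff_n f n x y] asks for continuity at (x,y) of [f] and of all its
    iterated partial derivatives of order at most [n]; required at every point
    of the open quadrant and for every [n], this is class C^oo there. *)
Definition smooth_pos2 (M : R -> R -> R) : Prop :=
  forall (n : nat) (x y : R), 0 < x -> 0 < y -> ex_diff_n M n x y.

Definition eq_pos (f g : R -> R) : Prop :=
  forall x : R, 0 < x -> f x = g x.

Definition eq_pos2 (M N : R -> R -> R) : Prop :=
  forall x y : R, 0 < x -> 0 < y -> M x y = N x y.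

Record is_mean (M : R -> R -> R) : Prop := {
  mean_pos : forall x y : R, 0 < x -> 0 < y -> 0 < M x y;
  mean_smooth : smooth_pos2 M;
  mean_between : forall x y : R, 0 < x -> 0 < y ->
    Rmin x y <= M x y <= Rmax x y;
  mean_sym : forall x y : R, 0 < x -> 0 < y -> M x y = M y x
}.

Definition charfun (M : R -> R -> R) (x : R) : R :=
  Derive_n (fun t : R => M t x) 2 x.

Definition is_normal_mean (M : R -> R -> R) : Prop :=
  is_mean M /\
  exists P : R -> R,
    smooth_pos P /\
    (forall x : R, 0 < x -> 0 < P x) /\
    (forall x y : R, 0 < x -> 0 < y ->
       M x y = (x * P x + y * P y) / (P x + P y)).

Definition minimal_class (C : (R -> R -> R) -> Prop) : Prop :=
  forall M1 M2 : R -> R -> R, C M1 -> C M2 ->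
    eq_pos (charfun M1) (charfun M2) -> eq_pos2 M1 M2.

Definition complete_class (C : (R -> R -> R) -> Prop) : Prop :=
  forall f : R -> R, smooth_pos f ->
    exists M : R -> R -> R, C M /\ eq_pos (charfun M) f.

(* Main.v *)
Require Import Defs.
From Stdlib Require Import Reals Lra.
From Coquelicot Require Import Coquelicot.
Open Scope R_scope.

(** A normal mean with weight [P] can be rewritten as
    [M t x = x + (t - x) * (P t / (P t + P x))], so only the derivative of the
    quotient survives in the second derivative at [t = x], which is twice it:
    the characteristic function is half the logarithmic derivative,
    [Q = P' / (2 P)] ([charfun_weighted_mean]).

    Minimality: if two weights have the same logarithmic derivative, their
    quotient has zero derivative, hence they are proportional on the half-line
    ([proportional_of_log_derive]), and a constant factor cancels in the mean.

    Completeness: given [f], solve [P' = 2 f P] by [P x = exp (2 * RInt f 1 x)].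
    It remains to see that [P] is smooth and that a positive smooth weight
    defines a smooth function of two variables.  Both facts are obtained
    without Leibniz formulas: one exhibits a set of functions whose members are
    differentiable (and continuous) with derivatives again in the set; all
    members are then smooth by induction on the order.  For [P] this set is
    the algebra generated by [P] and the smooth functions; for the mean it is
    the set [quadrant_alg] of expressions built from smooth functions of a
    single coordinate by sums, products and inverses. *)

(** * Smooth functions on the half-line *)

Lemma locally_pos (x : R) : 0 < x -> locally x (fun t => 0 < t).
Proof. intros Hx; exact (open_gt 0 x Hx). Qed.

(** Every iterated derivative of a member agrees on the half-line with a member.
    The derivative of [h] is only compared with [h'] at positive arguments:
    outside the half-line a total function and its [Derive] are arbitrary, so
    [Derive h] itself need not be one of the expressions in [K]. *)
Lemma smooth_pos_of_closed (K : (R -> R) -> Prop)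
  (HK : forall h, K h ->
    exists h', K h' /\ forall x, 0 < x -> is_derive h x (h' x)) :
  forall h, K h -> smooth_pos h.
Proof.
intros h Kh.
assert (HD : forall n, exists g, K g /\
  forall x, 0 < x -> Derive_n h n x = g x).
{ induction n as [|n [g [Kg Eg]]].
  - exists h; split; auto.
  - destruct (HK g Kg) as [g' [Kg' Dg]].
    exists g'; split; auto.
    intros x Hx; simpl.
    rewrite (Derive_ext_loc _ g).
    + apply is_derive_unique; auto.
    + generalize (locally_pos x Hx); apply filter_imp; auto. }
intros [|n] x Hx; simpl; auto.
destruct (HD n) as [g [Kg Eg]].
destruct (HK g Kg) as [g' [_ Dg]].
apply ex_derive_ext_loc with g.
- generalize (locally_pos x Hx); apply filter_imp; intros t Ht; symmetry; auto.
- exists (g' x); auto.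
Qed.

Lemma smooth_pos_is_derive (g : R -> R) (Hg : smooth_pos g) (x : R) :
  0 < x -> is_derive g x (Derive g x).
Proof. intros Hx; apply Derive_correct; exact (Hg 1%nat x Hx). Qed.

Lemma smooth_pos_Derive (g : R -> R) : smooth_pos g -> smooth_pos (Derive g).
Proof.
intros Hg [|n] x Hx; simpl; auto.
apply ex_derive_ext with (Derive_n g (S n)).
- intros t; rewrite (Derive_n_comp g n 1).
  now rewrite Nat.add_1_r.
- exact (Hg (S (S n)) x Hx).
Qed.

Lemma smooth_pos_id : smooth_pos (fun x => x).
Proof.
intros n x _; apply ex_derive_n_ext with (fun t => t ^ 1).
- intros t; ring.
- apply ex_derive_n_pow.
Qed.

Inductive alg (G : (R -> R) -> Prop) : (R -> R) -> Prop :=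
| alg_gen g : G g -> alg G g
| alg_plus g h : alg G g -> alg G h -> alg G (fun x => g x + h x)
| alg_mult g h : alg G g -> alg G h -> alg G (fun x => g x * h x).

(** By the sum and product rules it is enough to differentiate generators. *)
Lemma smooth_pos_alg (G : (R -> R) -> Prop)
  (HG : forall g, G g ->
    exists g', alg G g' /\ forall x, 0 < x -> is_derive g x (g' x)) :
  forall h, alg G h -> smooth_pos h.
Proof.
apply smooth_pos_of_closed.
intros h Hh; induction Hh
  as [g Gg | g h Ag [g' [Ag' Dg]] Ah [h' [Ah' Dh]]
           | g h Ag [g' [Ag' Dg]] Ah [h' [Ah' Dh]]]; auto.
- exists (fun x => g' x + h' x); split; [now apply alg_plus|].
  intros x Hx; exact (is_derive_plus _ _ _ _ _ (Dg x Hx) (Dh x Hx)).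
- exists (fun x => g' x * h x + g x * h' x); split.
  + apply alg_plus; now apply alg_mult.
  + intros x Hx.
    exact (is_derive_mult _ _ _ _ _ (Dg x Hx) (Dh x Hx) Rmult_comm).
Qed.

Lemma smooth_pos_mult (g h : R -> R) :
  smooth_pos g -> smooth_pos h -> smooth_pos (fun x => g x * h x).
Proof.
intros Hg Hh; apply (smooth_pos_alg smooth_pos).
- intros k Hk; exists (Derive k); split.
  + apply alg_gen, smooth_pos_Derive, Hk.
  + apply smooth_pos_is_derive, Hk.
- now apply alg_mult; apply alg_gen.
Qed.

(** The equation expresses the derivative of [P] inside the algebra generated
    by [P] and the smooth functions, so [P] bootstraps its own regularity. *)
Lemma smooth_pos_linear_ode (a P : R -> R) (Ha : smooth_pos a)
  (HP : forall x, 0 < x -> is_derive P x (a x * P x)) : smooth_pos P.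
Proof.
apply (smooth_pos_alg (fun h => smooth_pos h \/ h = P)).
- intros k [Hk | ->].
  + exists (Derive k); split.
    * apply alg_gen; left; apply smooth_pos_Derive, Hk.
    * apply smooth_pos_is_derive, Hk.
  + exists (fun x => a x * P x); split; auto.
    apply alg_mult; apply alg_gen; auto.
- apply alg_gen; auto.
Qed.

(** * Smooth functions on the open quadrant *)

Inductive quadrant_alg : (R -> R -> R) -> Prop :=
| quadrant_fst g : smooth_pos g -> quadrant_alg (fun x _ => g x)
| quadrant_snd g : smooth_pos g -> quadrant_alg (fun _ y => g y)
| quadrant_plus F G : quadrant_alg F -> quadrant_alg G ->
    quadrant_alg (fun x y => F x y + G x y)
| quadrant_mult F G : quadrant_alg F -> quadrant_alg G ->
    quadrant_alg (fun x y => F x y * G x y)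
| quadrant_inv F : quadrant_alg F ->
    (forall x y, 0 < x -> 0 < y -> F x y <> 0) ->
    quadrant_alg (fun x y => / F x y).

Lemma quadrant_const (c : R) : quadrant_alg (fun _ _ => c).
Proof.
apply (quadrant_fst (fun _ => c)); intros n x _; apply ex_derive_n_const.
Qed.

(** Symmetry in the coordinates reduces the second partial derivative to the
    first. *)
Lemma quadrant_swap (F : R -> R -> R) :
  quadrant_alg F -> quadrant_alg (fun x y => F y x).
Proof.
induction 1.
- now apply quadrant_snd.
- now apply quadrant_fst.
- now apply (quadrant_plus (fun x y => F y x) (fun x y => G y x)).
- now apply (quadrant_mult (fun x y => F y x) (fun x y => G y x)).
- apply (quadrant_inv (fun x y => F y x)); auto.
Qed.

Lemma quadrant_derive_fst (F : R -> R -> R) : quadrant_alg F ->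
  exists F1, quadrant_alg F1 /\
    forall x y, 0 < x -> 0 < y -> is_derive (fun z => F z y) x (F1 x y).
Proof.
induction 1 as [g Hg | g Hg | F G QF [F1 [QF1 DF]] QG [G1 [QG1 DG]]
  | F G QF [F1 [QF1 DF]] QG [G1 [QG1 DG]] | F QF [F1 [QF1 DF]] NF].
- exists (fun x _ => Derive g x); split.
  + apply quadrant_fst, smooth_pos_Derive, Hg.
  + intros x y Hx _; now apply smooth_pos_is_derive.
- exists (fun _ _ => 0); split; [apply quadrant_const|].
  intros x y _ _; exact (is_derive_const (g y) x).
- exists (fun x y => F1 x y + G1 x y); split; [now apply quadrant_plus|].
  intros x y Hx Hy.
  exact (is_derive_plus _ _ _ _ _ (DF x y Hx Hy) (DG x y Hx Hy)).
- exists (fun x y => F1 x y * G x y + F x y * G1 x y); split.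
  + apply quadrant_plus; now apply quadrant_mult.
  + intros x y Hx Hy.
    exact (is_derive_mult _ _ _ _ _ (DF x y Hx Hy) (DG x y Hx Hy) Rmult_comm).
- exists (fun x y => -1 * (F1 x y * (/ F x y * / F x y))); split.
  + apply quadrant_mult; [apply quadrant_const|].
    apply quadrant_mult; auto.
    apply quadrant_mult; now apply quadrant_inv.
  + intros x y Hx Hy.
    replace (-1 * (F1 x y * (/ F x y * / F x y)))
      with (- F1 x y / F x y ^ 2) by (field; auto).
    apply (is_derive_inv (fun z => F z y)); auto.
Qed.

Lemma quadrant_derive_snd (F : R -> R -> R) : quadrant_alg F ->
  exists F2, quadrant_alg F2 /\
    forall x y, 0 < x -> 0 < y -> is_derive (fun z => F x z) y (F2 x y).
Proof.
intros QF.
destruct (quadrant_derive_fst _ (quadrant_swap F QF)) as [F1 [QF1 DF]].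
exists (fun x y => F1 y x); split; [now apply quadrant_swap | auto].
Qed.

Lemma quadrant_continuity (F : R -> R -> R) : quadrant_alg F ->
  forall x y, 0 < x -> 0 < y -> continuity_2d_pt F x y.
Proof.
assert (HC : forall g x, smooth_pos g -> 0 < x -> continuity_pt g x).
{ intros g x Hg Hx; apply continuity_pt_filterlim.
  apply (ex_derive_continuous g x); exact (Hg 1%nat x Hx). }
induction 1; intros x y Hx Hy.
- apply (continuity_1d_2d_pt_comp g (fun u _ => u)); auto.
  apply continuity_2d_pt_id1.
- apply (continuity_1d_2d_pt_comp g (fun _ v => v)); auto.
  apply continuity_2d_pt_id2.
- apply continuity_2d_pt_plus; auto.
- apply continuity_2d_pt_mult; auto.
- apply continuity_2d_pt_inv; auto.
Qed.

Lemma locally_2d_quadrant (x y : R) : 0 < x -> 0 < y ->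
  locally_2d (fun u v => 0 < u /\ 0 < v) x y.
Proof.
intros Hx Hy.
exists (mkposreal _ (Rmin_pos x y Hx Hy)); simpl; intros u v Hu Hv.
pose proof (Rmin_l x y); pose proof (Rmin_r x y).
apply Rabs_def2 in Hu; apply Rabs_def2 in Hv; lra.
Qed.

(** The same induction as in one variable: both partial derivatives stay in
    the algebra, and each of its members is continuous. *)
Lemma smooth_pos2_quadrant (F : R -> R -> R) :
  quadrant_alg F -> smooth_pos2 F.
Proof.
intros QF n; revert F QF; induction n as [|n IH]; intros F QF x y Hx Hy;
  simpl; (split; [now apply quadrant_continuity|]); auto.
destruct (quadrant_derive_fst F QF) as [F1 [QF1 D1]].
destruct (quadrant_derive_snd F QF) as [F2 [QF2 D2]].
repeat split.
- exists (F1 x y); auto.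
- exists (F2 x y); auto.
- apply ex_diff_n_ext_loc with F1; auto.
  generalize (locally_2d_quadrant x y Hx Hy); apply locally_2d_impl.
  apply locally_2d_forall; intros u v [Hu Hv].
  symmetry; apply is_derive_unique; auto.
- apply ex_diff_n_ext_loc with F2; auto.
  generalize (locally_2d_quadrant x y Hx Hy); apply locally_2d_impl.
  apply locally_2d_forall; intros u v [Hu Hv].
  symmetry; apply is_derive_unique; auto.
Qed.

(** * The mean defined by a weight and its characteristic function *)

Definition weighted_mean (P : R -> R) (x y : R) : R :=
  (x * P x + y * P y) / (P x + P y).

Lemma weighted_mean_normal (P : R -> R) :
  smooth_pos P -> (forall x, 0 < x -> 0 < P x) ->
  is_normal_mean (weighted_mean P).
Proof.
intros HP PP.
assert (HB : forall x y, 0 < x -> 0 < y ->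
  Rmin x y <= weighted_mean P x y <= Rmax x y).
{ intros x y Hx Hy; unfold weighted_mean.
  pose proof (PP x Hx); pose proof (PP y Hy).
  pose proof (Rmin_l x y); pose proof (Rmin_r x y).
  pose proof (Rmax_l x y); pose proof (Rmax_r x y).
  split; [apply Rle_div_r | apply Rle_div_l]; try lra; nra. }
split; [|now exists P].
split; auto.
- intros x y Hx Hy.
  apply Rlt_le_trans with (Rmin x y); [now apply Rmin_pos | now apply HB].
- apply smooth_pos2_quadrant.
  apply (quadrant_mult (fun x y => x * P x + y * P y)
    (fun x y => / (P x + P y))).
  + apply (quadrant_plus (fun x _ => x * P x) (fun _ y => y * P y)).
    * apply (quadrant_fst (fun x => x * P x)); apply smooth_pos_mult; auto.
      apply smooth_pos_id.
    * apply (quadrant_snd (fun x => x * P x)); apply smooth_pos_mult; auto.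
      apply smooth_pos_id.
  + apply (quadrant_inv (fun x y => P x + P y)).
    * apply (quadrant_plus (fun x _ => P x) (fun _ y => P y)).
      -- now apply quadrant_fst.
      -- now apply quadrant_snd.
    * intros x y Hx Hy; pose proof (PP x Hx); pose proof (PP y Hy); lra.
- intros x y Hx Hy; unfold weighted_mean.
  pose proof (PP x Hx); pose proof (PP y Hy); field; lra.
Qed.

(** In the second derivative of [(t - x) * g t] at [t = x] only [2 * g' x]
    survives; here [g t = P t / (P t + P x)] has derivative
    [P' x * P x / (2 * P x) ^ 2] at [x]. *)
Lemma charfun_weighted_mean (M : R -> R -> R) (P : R -> R) :
  smooth_pos P -> (forall x, 0 < x -> 0 < P x) ->
  (forall x y, 0 < x -> 0 < y -> M x y = weighted_mean P x y) ->
  forall x, 0 < x -> charfun M x = Derive P x / (2 * P x).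
Proof.
intros HP PP HM x Hx; unfold charfun.
rewrite (Derive_n_ext_loc _ (fun t => weighted_mean P t x)).
2:{ generalize (locally_pos x Hx); apply filter_imp; auto. }
pose proof (PP x Hx) as Px.
assert (EP : forall t, 0 < t -> ex_derive P t)
  by (intros t Ht; exact (HP 1%nat t Ht)).
assert (D1 : forall t, 0 < t -> Derive (fun t => weighted_mean P t x) t =
  P t / (P t + P x) +
  (t - x) * (Derive P t * P x / ((P t + P x) * (P t + P x)))).
{ intros t Ht; pose proof (PP t Ht) as Pt.
  apply is_derive_unique; unfold weighted_mean; auto_derive.
  - repeat split; auto; lra.
  - change (Derive (fun z => P z) t) with (Derive P t); field; lra. }
simpl; rewrite (Derive_ext_loc _ (fun t => P t / (P t + P x) +
  (t - x) * (Derive P t * P x / ((P t + P x) * (P t + P x))))).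
2:{ generalize (locally_pos x Hx); apply filter_imp; intros t Ht.
    apply (D1 t Ht). }
apply is_derive_unique.
assert (EP' : ex_derive (Derive P) x) by exact (HP 2%nat x Hx).
set (P1 := Derive P) in *.
auto_derive.
- repeat split; auto; nra.
- change (Derive (fun z => P z) x) with (P1 x); field; lra.
Qed.

(** The quotient [P1 / P2] has zero derivative. *)
Lemma proportional_of_log_derive (P1 P2 : R -> R) :
  smooth_pos P1 -> smooth_pos P2 ->
  (forall x, 0 < x -> 0 < P2 x) ->
  (forall x, 0 < x -> Derive P1 x * P2 x = P1 x * Derive P2 x) ->
  forall x, 0 < x -> P1 x = P1 1 / P2 1 * P2 x.
Proof.
intros H1 H2 PP E x Hx.
assert (D : forall t, 0 < t -> is_derive (fun t => P1 t / P2 t) t 0).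
{ intros t Ht; pose proof (PP t Ht) as Pt.
  replace 0 with
    ((Derive P1 t * P2 t - P1 t * Derive P2 t) / P2 t ^ 2)
    by (rewrite (E t Ht); field; lra).
  apply is_derive_div; try apply smooth_pos_is_derive; auto; lra. }
assert (Q : P1 x / P2 x = P1 1 / P2 1).
{ destruct (Rtotal_order x 1) as [L | [-> | L]]; auto; [|symmetry];
    apply (eq_is_derive (fun t => P1 t / P2 t)); auto;
    intros t Ht; apply D; lra. }
pose proof (PP x Hx); rewrite <- Q; field; lra.
Qed.

Lemma minimal_normal_means : minimal_class is_normal_mean.
Proof.
intros M1 M2 [_ [P1 [S1 [PP1 E1]]]] [_ [P2 [S2 [PP2 E2]]]] EQ.
assert (EP : forall x, 0 < x -> P1 x = P1 1 / P2 1 * P2 x).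
{ apply proportional_of_log_derive; auto.
  intros x Hx; specialize (EQ x Hx).
  rewrite (charfun_weighted_mean M1 P1), (charfun_weighted_mean M2 P2) in EQ;
    auto.
  pose proof (PP1 x Hx); pose proof (PP2 x Hx).
  replace (Derive P1 x) with (2 * P1 x * (Derive P1 x / (2 * P1 x)))
    by (field; lra).
  rewrite EQ; field; lra. }
intros x y Hx Hy; rewrite E1, E2, (EP x), (EP y); auto.
pose proof (PP2 x Hx); pose proof (PP2 y Hy).
pose proof (PP1 1 Rlt_0_1); pose proof (PP2 1 Rlt_0_1).
field; repeat split; try lra.
rewrite <- Rmult_plus_distr_l; apply Rmult_integral_contrapositive; lra.
Qed.

Lemma is_derive_primitive_pos (f : R -> R) : smooth_pos f ->
  forall x, 0 < x -> is_derive (RInt f 1) x (f x).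
Proof.
intros Hf.
assert (HC : forall z, 0 < z -> continuous f z).
{ intros z Hz; apply (ex_derive_continuous f z); exact (Hf 1%nat z Hz). }
intros x Hx; apply (is_derive_RInt f (RInt f 1) 1); auto.
generalize (locally_pos x Hx); apply filter_imp; intros t Ht.
apply (RInt_correct f 1 t), ex_RInt_continuous; intros z [Hz _]; apply HC.
pose proof (Rmin_pos 1 t Rlt_0_1 Ht); lra.
Qed.

Lemma complete_normal_means : complete_class is_normal_mean.
Proof.
intros f Hf.
set (P := fun x => exp (2 * RInt f 1 x)).
assert (PP : forall x, 0 < x -> 0 < P x) by (intros; apply exp_pos).
assert (DP : forall x, 0 < x -> is_derive P x (2 * f x * P x)).
{ intros x Hx; unfold P.
  pose proof (is_derive_primitive_pos f Hf x Hx) as DF.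
  set (F := RInt f 1) in *.
  auto_derive; [now exists (f x)|].
  change (Derive (fun z => F z) x) with (Derive F x).
  rewrite (is_derive_unique _ _ _ DF); ring. }
assert (SP : smooth_pos P).
{ apply (smooth_pos_linear_ode (fun x => 2 * f x)); auto.
  intros n x Hx; apply ex_derive_n_scal_l; auto. }
exists (weighted_mean P); split; [now apply weighted_mean_normal|].
intros x Hx; rewrite (charfun_weighted_mean _ P); auto.
rewrite (is_derive_unique _ _ _ (DP x Hx)).
pose proof (PP x Hx); field; lra.
Qed.

Theorem corollary3p5 :
  minimal_class is_normal_mean /\ complete_class is_normal_mean.
Proof. exact (conj minimal_normal_means complete_normal_means). Qed.
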